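(* Let $K$ be a finite set with $|K|\ge 2$. There exist $\varepsilon>0$ and a sequence $(u^l)_{l\ge 1}$ of information structures in $\mathcal U$ such that $d(u^l,u^p)>\varepsilon$ whenever $l\ne p$.
   Context: $\mathbb N$ is the set of nonnegative integers. An information structure is a probability $u\in\Delta(K\times\mathbb N\times\mathbb N)$ on triples $(k,c,d)$; $k$ is the state, $c$ the signal of player 1 (maximizer), $d$ the signal of player 2 (minimizer). $\mathcal U$ is the set of all information structures. A payoff function is a map $g:K\times I\times J\to[-1,1]$ with $I,J$ finite nonempty sets; $\mathcal G$ is the set of all payoff functions. $\mathrm{val}(u,g)$ is the value of the zero-sum Bayesian game in which $(k,c,d)$ is drawn from $u$, player 1 learns $c$, player 2 learns $d$, they simultaneously choose $i\in I$, $j\in J$ (mixed actions depending on own signal allowed), and player 1 receives $g(k,i,j)$ from player 2. The value-based distance is $d(u,v)=\sup_{g\in\mathcal G}|\mathrm{val}(u,g)-\mathrm{val}(v,g)|$. *)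

(* Defs.v *)
From mathcomp Require Import all_boot all_order all_algebra.
From mathcomp Require Import all_classical all_reals all_analysis.

Set Implicit Arguments.
Unset Strict Implicit.
Unset Printing Implicit Defensive.

Import Order.TTheory GRing.Theory Num.Theory.

Local Open Scope classical_set_scope.
Local Open Scope ring_scope.

(* A probability on the countable set K * nat * nat, given by its mass
   function. *)
Record info_structure (R : realType) (K : finType) := InfoStructure {
  mass :> K * nat * nat -> R ;
  mass_ge0 : forall x, 0 <= mass x ;
  mass_sum1 : \esum_(x in [set: K * nat * nat]) (mass x)%:E = 1%:E }.

Section Game.
Variables (R : realType) (K : finType).
Implicit Types (u v : info_structure R K) (I J : finType).

(* [esum] is meant for nonnegative families, so a signed sum is taken as the
   difference of the sums of its positive and negative parts; for bounded f
   both are finite. *)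
Definition expect u (f : K * nat * nat -> R) : R :=
  let h := fun x => (u x * f x)%:E in
  fine (\esum_(x in [set: K * nat * nat]) (h^\+)%E x) -
  fine (\esum_(x in [set: K * nat * nat]) (h^\-)%E x).

(* Behaviour strategies: a mixed action for each signal received. *)
Definition strategy I : set (nat -> I -> R) :=
  [set s | forall c, (forall i, 0 <= s c i) /\ \sum_i s c i = 1].

Definition payoff u I J (g : K -> I -> J -> R)
    (s : nat -> I -> R) (t : nat -> J -> R) : R :=
  expect u (fun x => let: (k, c, d) := x in
    \sum_i \sum_j s c i * t d j * g k i j).

Arguments strategy I : clear implicits.

Definition maxmin u I J (g : K -> I -> J -> R) : R :=
  sup [set inf [set payoff u g s t | t in strategy J] | s in strategy I].

Definition minmax u I J (g : K -> I -> J -> R) : R :=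
  inf [set sup [set payoff u g s t | s in strategy I] | t in strategy J].

Definition is_value u I J (g : K -> I -> J -> R) : set R :=
  [set w | maxmin u g = w /\ minmax u g = w].

(* The default 0 is never used when I and J are nonempty and g is bounded,
   by the minimax theorem. *)
Definition game_val u I J (g : K -> I -> J -> R) : R := xget 0 (is_value u g).

Definition payoff_function I J (g : K -> I -> J -> R) : Prop :=
  [/\ (0 < #|I|)%N, (0 < #|J|)%N & forall k i j, -1 <= g k i j <= 1].

Definition value_dist u v : R :=
  sup [set r | exists (I J : finType) (g : K -> I -> J -> R),
         payoff_function g /\ r = `|game_val u g - game_val v g| ].

End Game.

Arguments strategy : clear implicits.

(* Main.v *)
Require Import Defs.
From mathcomp Require Import all_boot all_order all_algebra.
From mathcomp Require Import all_classical all_reals all_analysis.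
From mathcomp Require Import ring lra.

(** Both players hold pieces of one chain. Let X = F * F for the field F with
five elements, and let B (t, y) (b1, b2) = y + b1 t + b2 t^2. Draw f_0, f_1,
..., f_(N-1) independently and uniformly in X. The owner of position s, which
is player 1 for even s and player 2 for odd s, learns f_s together with the
value v_s = B f_(s-1) f_s, a small piece of information on the opponent's
previous position. The state is a coin whose bias is an injective function of
the entry (f_0, v_0), so that only player 1 knows something directly about it.
The structure u^l has N = 2l positions: a larger l adds knowledge at ever
higher order.

The game that separates u^l from u^p for every p > l is a quiz. The players
report the entries of the positions 0, ..., 2l and the reports are tested in
this order: test s asks whether the reported v_(s+1) equals B of the reported
f_s and f_(s+1). The owner of position s+1 pays 1 to the opponent if this is
the first test to fail, in units of a small stake. The last test, the only one
that concerns position 2l, costs player 1 only 1/5. On a far larger scale,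
player 1 is also paid a quadratic score for the forecast of the state that the
report at position 0 implies.

Truthful reporting is a saddle point of the quiz, in u^l as in u^p. The score
makes a lie at position 0 unprofitable. Consider the first lie of a player, at
position r+1. All that this player knows about f_r is the point value
B f_r f_(r+1): five candidates remain, and they are equally likely since the
f_s are independent. A pair of values (B f b, B f b') fits at most two elements
f ([card_two_parabolas]), so at most two of the five candidates let the lie
pass. Thus the liar is blamed at once with probability at least 3/5, and cannot
win more than 1 with the remaining 2/5: lying costs at least 1/5 on average
([lie_blamed]), whatever happens at the later tests, so that only one step of
the chain enters the argument.

In u^p, player 1 knows position 2l and the truth passes all the tests. In u^l
position 2l does not exist; player 1, who knows nothing about f_(2l-1), can
only guess and fails the last test with probability 4/5. As this test costs
1/5, guessing at the end is not worse than an earlier lie, so the truth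
completed by a constant guess is still optimal. The two values therefore differ
by 1/5 * 4/5 = 4/25 of the stake of the tests, a number that depends neither on
l nor on p ([quiz_val_gap]). Since the saddle points are explicit and pure, the
values can be computed directly ([game_val_interim_saddle]). *)

Set Implicit Arguments.
Unset Strict Implicit.
Unset Printing Implicit Defensive.

Import Order.TTheory GRing.Theory Num.Theory.

Local Open Scope ring_scope.

(** * Information structures and games with a finite prior *)

Lemma maxr_subr_oppr (R : realDomainType) (y : R) :
  Num.max y 0 - Num.max (- y) 0 = y.
Proof.
have [le0|/ltW ge0] := leP y 0.
  by rewrite max_l ?oppr_ge0// sub0r opprK.
by rewrite max_r ?oppr_le0// subr0.
Qed.

Section FinitePrior.
Variables (R : realType) (K Om S T : finType).
Variables (mu : Om -> R) (state : Om -> K) (sig1 : Om -> S) (sig2 : Om -> T).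
Hypotheses (mu_ge0 : forall w, 0 <= mu w) (mu_sum1 : \sum_w mu w = 1).

Definition outcome w : K * nat * nat :=
  (state w, pickle (sig1 w), pickle (sig2 w)).

Definition law x : R := \sum_(w | outcome w == x) mu w.

(** The law has finite support, so the sum over the infinite set of outcomes
collapses to the finite sum over the scenarios. *)
Lemma esum_law (f : K * nat * nat -> R) : (forall x, 0 <= f x) ->
  (\esum_(x in [set: K * nat * nat]) (law x * f x)%:E =
   (\sum_w mu w * f (outcome w))%:E)%E.
Proof.
move=> f0.
pose F w x : \bar R := (if outcome w == x then mu w * f (outcome w) else 0)%:E.
have F0 w x : (0 <= F w x)%E.
  by rewrite lee_fin; case: ifP => // _; rewrite mulr_ge0.
rewrite (eq_esum
  (b := fun x => (\sum_(w <- index_enum Om | true) F w x)%E)); last first.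
  move=> x _; rewrite sumEFin big_distrl [in LHS]big_mkcond /=.
  by congr EFin; apply: eq_bigr => w _; case: eqP => [<-|].
rewrite esum_sum => [|x w _ _]; last exact: F0.
rewrite -sumEFin; apply: eq_bigr => w _.
rewrite -(@esum_set1 _ _ (outcome w) (fun x => (mu w * f x)%:E)); last first.
  by rewrite lee_fin mulr_ge0.
rewrite [RHS]esum_mkcond; apply: eq_esum => x _.
rewrite /F; case: eqP => [->|ne]; first by rewrite mem_set.
by rewrite memNset// => /esym.
Qed.

Lemma law_ge0 x : 0 <= law x.
Proof. by rewrite sumr_ge0. Qed.

Lemma law_sum1 : (\esum_(x in [set: K * nat * nat]) (law x)%:E = 1%:E)%E.
Proof.
rewrite -mu_sum1 -[in RHS](eq_bigr _ (fun w _ => mulr1 (mu w))).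
rewrite -(esum_law (f := fun=> 1)) //.
by apply: eq_esum => x _; rewrite mulr1.
Qed.

Definition from_prior : info_structure R K := InfoStructure law_ge0 law_sum1.

Lemma expect_from_prior f :
  expect from_prior f = \sum_w mu w * f (outcome w).
Proof.
rewrite /expect /=.
rewrite (eq_esum (b := fun x => (law x * Num.max (f x) 0)%:E)); last first.
  move=> x _; rewrite funeposE -EFin_max; congr EFin.
  by rewrite maxr_pMr ?law_ge0// mulr0.
rewrite (eq_esum (a := ((fun x => (law x * f x)%:E)^\-)%E)
                 (b := fun x => (law x * Num.max (- f x) 0)%:E)); last first.
  move=> x _; rewrite -funeposN funeposE /= -EFin_max; congr EFin.
  by rewrite maxr_pMr ?law_ge0// mulr0 mulrN.
rewrite !esum_law => [|x|x]; rewrite ?le_max ?lexx ?orbT//.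
rewrite /= -sumrB; apply: eq_bigr => w _; rewrite -mulrBr; congr (_ * _).
exact: maxr_subr_oppr.
Qed.

(** Signals reach a strategy only through their code; [a0] is played on the
integers that encode no signal. *)
Definition pure (A : finType) (Q : countType) (a0 : A) (f : Q -> A)
    (n : nat) (a : A) : R :=
  (a == oapp f a0 (unpickle n))%:R.

Lemma pure_strategy (A : finType) (Q : countType) (a0 : A) (f : Q -> A) :
  strategy R A (pure a0 f).
Proof.
move=> n; split=> [a|]; first exact: ler0n.
rewrite /pure (bigD1 (oapp f a0 (unpickle n)))//= eqxx.
by rewrite big1 ?addr0// => a /negPf->.
Qed.

Lemma sum_pure (A : finType) (Q : countType) (a0 : A) (f : Q -> A) q
    (F : A -> R) :
  \sum_a pure a0 f (pickle q) a * F a = F (f q).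
Proof.
rewrite (bigD1 (f q))//= big1 ?addr0 => [|a /negPf na];
  by rewrite /pure pickleK /= ?eqxx ?na ?mul1r ?mul0r.
Qed.

(** Optimality may be checked signal by signal and action by action: given the
own signal, the payoff is linear in the mixed action, and signals do not
interact. *)
Lemma interim_dominance (A Q : finType) (sig : Om -> Q) (t : nat -> A -> R)
    (best : Q -> A) (F : Om -> A -> R) :
  strategy R A t ->
  (forall q a, 0 <= \sum_(w | sig w == q) mu w * (F w a - F w (best q))) ->
  \sum_w mu w * F w (best (sig w)) <=
  \sum_w mu w * \sum_a t (pickle (sig w)) a * F w a.
Proof.
move=> st dom; rewrite -subr_ge0 -sumrB.
rewrite (partition_big sig xpredT)//=; apply: sumr_ge0 => q _.
have -> : \sum_(w | sig w == q) (mu w * (\sum_a t (pickle (sig w)) a * F w a)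
             - mu w * F w (best (sig w))) =
   \sum_a t (pickle q) a *
     \sum_(w | sig w == q) mu w * (F w a - F w (best q)).
  under [RHS]eq_bigr do rewrite big_distrr /=.
  rewrite exchange_big /=; apply: eq_bigr => w /eqP->.
  rewrite -mulrBr -[X in _ - X]mul1r -(st (pickle q)).2 big_distrl /= -sumrB.
  by rewrite big_distrr /=; apply: eq_bigr => a _; ring.
by apply: sumr_ge0 => a _; rewrite mulr_ge0 ?(st _).1.
Qed.

Section Payoffs.
Variables (I J : finType) (g : K -> I -> J -> R).

Lemma payoff_from_prior s t : payoff from_prior g s t =
  \sum_w mu w * \sum_i \sum_j
    s (pickle (sig1 w)) i * t (pickle (sig2 w)) j * g (state w) i j.
Proof. exact: expect_from_prior. Qed.

Lemma payoff_pure1 i0 f t : payoff from_prior g (pure i0 f) t =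
  \sum_w mu w * \sum_j t (pickle (sig2 w)) j * g (state w) (f (sig1 w)) j.
Proof.
rewrite payoff_from_prior; apply: eq_bigr => w _; congr (_ * _).
rewrite -(sum_pure i0 f (sig1 w) (fun i =>
  \sum_j t (pickle (sig2 w)) j * g (state w) i j)); apply: eq_bigr => i _.
by rewrite big_distrr; apply: eq_bigr => j _; rewrite /= mulrA.
Qed.

Lemma payoff_pure2 j0 f s : payoff from_prior g s (pure j0 f) =
  \sum_w mu w * \sum_i s (pickle (sig1 w)) i * g (state w) i (f (sig2 w)).
Proof.
rewrite payoff_from_prior; apply: eq_bigr => w _; congr (_ * _).
apply: eq_bigr => i _.
rewrite -(sum_pure j0 f (sig2 w) (g (state w) i)) big_distrr.
by apply: eq_bigr => j _; rewrite /= mulrA.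
Qed.

Lemma payoff_bound s t : (forall k i j, -1 <= g k i j <= 1) ->
  strategy R I s -> strategy R J t -> -1 <= payoff from_prior g s t <= 1.
Proof.
move=> gb ss st; rewrite payoff_from_prior -ler_norml -mu_sum1.
apply: le_trans (ler_norm_sum _ _ _) _; apply: ler_sum => w _.
rewrite normrM ger0_norm//= -[leRHS]mulr1 ler_wpM2l//.
rewrite -(ss (pickle (sig1 w))).2.
apply: le_trans (ler_norm_sum _ _ _) _; apply: ler_sum => i _.
rewrite -[leRHS]mulr1 -(st (pickle (sig2 w))).2 big_distrr /=.
apply: le_trans (ler_norm_sum _ _ _) _; apply: ler_sum => j _.
have ge0 : 0 <= s (pickle (sig1 w)) i * t (pickle (sig2 w)) j.
  by rewrite mulr_ge0 ?(ss _).1 ?(st _).1.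
by rewrite normrM (ger0_norm ge0) ler_piMr// ler_norml.
Qed.

Lemma maxmin_bound : payoff_function g -> -1 <= maxmin from_prior g <= 1.
Proof.
move=> [/card_gt0P[i0 _] /card_gt0P[j0 _] gb].
pose s1 := pure i0 (fun _ : nat => i0); have ss : strategy R I s1.
  exact: pure_strategy.
pose t1 := pure j0 (fun _ : nat => j0); have st : strategy R J t1.
  exact: pure_strategy.
have inner s : strategy R I s ->
    -1 <= inf [set payoff from_prior g s t | t in strategy R J] <= 1.
  move=> hs; apply/andP; split.
    apply: lb_le_inf => [|_ [t ht <-]].
      by exists (payoff from_prior g s t1), t1.
    by case/andP: (payoff_bound gb hs ht).
  apply: le_trans (ge_inf _ _) (proj2 (andP (payoff_bound gb hs st))).
    by exists (-1) => _ [t ht <-]; case/andP: (payoff_bound gb hs ht).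
  by exists t1.
apply/andP; split.
  apply: le_trans (proj1 (andP (inner _ ss))) (ub_le_sup _ _).
    by exists 1 => _ [s hs <-]; case/andP: (inner s hs).
  by exists s1.
apply: ge_sup => [|_ [s hs <-]]; last by case/andP: (inner s hs).
by exists (inf [set payoff from_prior g s1 t | t in strategy R J]), s1.
Qed.

(** A bound uniform in the game, without which the supremum that defines the
distance would be meaningless. *)
Lemma game_val_bound : payoff_function g -> -1 <= game_val from_prior g <= 1.
Proof.
move=> gb; rewrite /game_val; case: xgetP => [_ _ [<- _]|_]; last lra.
exact: maxmin_bound.
Qed.

(** A saddle point forces [maxmin] and [minmax] to coincide. *)
Lemma game_val_saddle (w : R) (s0 : nat -> I -> R) (t0 : nat -> J -> R) :
  (forall k i j, -1 <= g k i j <= 1) ->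
  strategy R I s0 -> strategy R J t0 ->
  (forall t, strategy R J t -> w <= payoff from_prior g s0 t) ->
  (forall s, strategy R I s -> payoff from_prior g s t0 <= w) ->
  game_val from_prior g = w.
Proof.
move=> gb hs0 ht0 lo hi.
have lb s : strategy R I s ->
    has_lbound [set payoff from_prior g s t | t in strategy R J].
  by move=> hs; exists (-1) => _ [t ht <-]; case/andP: (payoff_bound gb hs ht).
have ub t : strategy R J t ->
    has_ubound [set payoff from_prior g s t | s in strategy R I].
  by move=> ht; exists 1 => _ [s hs <-]; case/andP: (payoff_bound gb hs ht).
have infle s : strategy R I s ->
    inf [set payoff from_prior g s t | t in strategy R J] <= w.
  by move=> hs; apply: le_trans (ge_inf (lb s hs) _) (hi s hs); exists t0.
have supge t : strategy R J t ->
    w <= sup [set payoff from_prior g s t | s in strategy R I].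
  by move=> ht; apply: le_trans (lo t ht) (ub_le_sup (ub t ht) _); exists s0.
have maxminE : maxmin from_prior g = w.
  apply/eqP; rewrite eq_le; apply/andP; split.
    apply: ge_sup => [|_ [s hs <-]]; last exact: infle.
    by exists (inf [set payoff from_prior g s0 t | t in strategy R J]), s0.
  apply: (@le_trans _ _
    (inf [set payoff from_prior g s0 t | t in strategy R J])).
    apply: lb_le_inf => [|_ [t ht <-]]; last exact: lo.
    by exists (payoff from_prior g s0 t0), t0.
  apply: ub_le_sup; last by exists s0.
  by exists w => _ [s hs <-]; apply: infle.
have minmaxE : minmax from_prior g = w.
  apply/eqP; rewrite eq_le; apply/andP; split; last first.
    apply: lb_le_inf => [|_ [t ht <-]]; last exact: supge.
    by exists (sup [set payoff from_prior g s t0 | s in strategy R I]), t0.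
  apply: (@le_trans _ _
    (sup [set payoff from_prior g s t0 | s in strategy R I])).
    apply: ge_inf; last by exists t0.
    by exists w => _ [t ht <-]; apply: supge.
  apply: ge_sup => [|_ [s hs <-]]; last exact: hi.
  by exists (payoff from_prior g s0 t0), s0.
by apply: xget_unique => // v [<- _].
Qed.

(** A saddle point in pure strategies is thus verified through finitely many
finite sums, one for each signal and action. *)
Lemma game_val_interim_saddle (f1 : S -> I) (f2 : T -> J) :
  payoff_function g ->
  (forall q j, 0 <= \sum_(w | sig2 w == q)
     mu w * (g (state w) (f1 (sig1 w)) j - g (state w) (f1 (sig1 w)) (f2 q))) ->
  (forall q i, \sum_(w | sig1 w == q)
     mu w * (g (state w) i (f2 (sig2 w)) - g (state w) (f1 q) (f2 (sig2 w)))
     <= 0) ->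
  game_val from_prior g =
    \sum_w mu w * g (state w) (f1 (sig1 w)) (f2 (sig2 w)).
Proof.
move=> [/card_gt0P[i0 _] /card_gt0P[j0 _] gb] opt2 opt1.
apply: (@game_val_saddle _ (pure i0 f1) (pure j0 f2) gb);
  try exact: pure_strategy.
- move=> t ht; rewrite payoff_pure1.
  exact: (interim_dominance (F := fun w j => g (state w) (f1 (sig1 w)) j)).
- move=> s hs; rewrite payoff_pure2 -lerN2 -!sumrN.
  have := @interim_dominance _ _ sig1 s f1
    (fun w i => - g (state w) i (f2 (sig2 w))) hs.
  under [X in (_ -> X <= _) -> _]eq_bigr do rewrite mulrN.
  move=> H; apply: le_trans (H _) _ => [q i|].
    rewrite -oppr_le0 -sumrN; apply: le_trans (opt1 q i).
    by apply: ler_sum => w /eqP <-; lra.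
  apply: ler_sum => w _; rewrite -mulrN -sumrN.
  by under eq_bigr do rewrite mulrN.
Qed.
End Payoffs.

End FinitePrior.

(** * Updating one coordinate of a finite sequence *)

Section FiniteSequences.
Variables (A : Type) (a0 : A).

(** Reading a sequence at any integer, with a default beyond its length, lets
sequences of different lengths be compared position by position. *)
Definition item n (w : {ffun 'I_n -> A}) (s : nat) : A := oapp w a0 (insub s).

Lemma item_finfun n (f : nat -> A) s :
  item [ffun i : 'I_n => f i] s = if (s < n)%N then f s else a0.
Proof.
by rewrite /item; case: insubP => [i -> <-|/negPf->]; rewrite //= ffunE.
Qed.

Definition upd n (w : {ffun 'I_n -> A}) (i : 'I_n) a : {ffun 'I_n -> A} :=
  [ffun j => if j == i then a else w j].

Lemma item_upd n (w : {ffun 'I_n -> A}) (i : 'I_n) a s :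
  item (upd w i a) s = if s == i then a else item w s.
Proof.
rewrite /item; case: insubP => [j _ <-|]; rewrite /= ?ffunE ?val_eqE//.
by case: eqP => // -> /negP[].
Qed.

Lemma upd_upd n (w : {ffun 'I_n -> A}) i a b : upd (upd w i a) i b = upd w i b.
Proof. by apply/ffunP => j; rewrite !ffunE; case: eqP. Qed.

Lemma upd_id n (w : {ffun 'I_n -> A}) i : upd w i (w i) = w.
Proof. by apply/ffunP => j; rewrite !ffunE; case: eqP => [->|]. Qed.

End FiniteSequences.

(** Drawing coordinate [i] afresh does not change a sum over all sequences,
because exchanging the old and the new value is an involution. Hence a sum
restricted to [P] is nonpositive as soon as it is so on each class of sequences
that differ at [i] only. This replaces conditioning on a signal. *)
Lemma resample (R : numDomainType) (X : finType) n (i : 'I_n)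
    (P : pred {ffun 'I_n -> X}) (F : {ffun 'I_n -> X} -> R) :
  (forall w, P w -> \sum_(x | P (upd w i x)) F (upd w i x) <= 0) ->
  \sum_(w | P w) F w <= 0.
Proof.
move=> H; have [w0 Pw0|] := pickP P; last first.
  by move=> P0; rewrite big_pred0.
have X0 : (0 < #|X|)%N by apply/card_gt0P; exists (w0 i).
pose G w := if P w then F w else 0.
have swap : \sum_w \sum_x G (upd w i x) = \sum_w \sum_(x : X) G w.
  rewrite !pair_big /=.
  pose h (q : {ffun 'I_n -> X} * X) := (upd q.1 i q.2, q.1 i).
  have hK : involutive h.
    by case=> w x; rewrite /h /= upd_upd upd_id ffunE eqxx.
  rewrite (reindex_inj (inv_inj hK)) /=.
  by apply: eq_bigr => q _; rewrite /h /= upd_upd upd_id.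
have : #|X|%:R * \sum_(w | P w) F w <= 0.
  rewrite big_mkcond /= mulr_sumr.
  have -> : \sum_w #|X|%:R * (if P w then F w else 0) = \sum_w \sum_(x : X) G w.
    by apply: eq_bigr => w _; rewrite sumr_const mulr_natl.
  rewrite -swap; apply: sumr_le0 => w _.
  (* A class that meets P is represented by one of its members in P. *)
  have [x Px|none] := pickP (fun x => P (upd w i x)); last first.
    by rewrite big1 // => x _; rewrite /G none.
  rewrite -big_mkcond /=; have := H _ Px.
  have eu z : upd (upd w i x) i z = upd w i z by rewrite upd_upd.
  rewrite (eq_bigl _ _ (fun z => congr1 P (eu z))).
  by rewrite (eq_bigr _ (fun z _ => congr1 F (eu z))).
by rewrite pmulr_rle0 ?ltr0n.
Qed.

(** * The chain of signals and the first failing test *)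

Section Chain.
(** [B f b] is what the owner of [b] learns about the preceding element [f]. *)
Variables (R : realFieldType) (X V : finType) (x0 : X) (v0 : V).
Variable B : X -> X -> V.
Hypothesis fiber : forall b v, #|[set x | B x b == v]| = 5%N.
Hypothesis collide : forall b v b' v', (b, v) != (b', v') ->
  (#|[set x | (B x b == v) && (B x b' == v')]| <= 2)%N.

Let E := (X * V)%type.
Let e0 : E := (x0, v0).

Section Signals.
Variable N : nat.
Implicit Types (w : {ffun 'I_N -> X}) (y : nat -> E).

(** Position 0 has no predecessor, whence the dummy value [v0]. The positions
beyond the chain read [(x0, v0)]: this is the guess of a player asked about a
position that the chain does not have. *)
Definition entry w (s : nat) : E :=
  if (s < N)%N then
    (item x0 w s, if s is r.+1 then B (item x0 w r) (item x0 w s) else v0)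
  else e0.

(** [par] is the parity of the positions that the player owns: [false] for
player 1, [true] for player 2. *)
Definition view par w : {ffun 'I_N -> E} :=
  [ffun s : 'I_N => if odd s == par then entry w s else e0].

Definition interleave par y (z : nat -> E) s :=
  if odd s == par then y s else z s.

Lemma item_view par w s : odd s == par -> item e0 (view par w) s = entry w s.
Proof.
move=> sp; rewrite /view.
rewrite (item_finfun _ _ (fun s => if odd s == par then entry w s else e0)).
by rewrite sp /entry; case: ltnP.
Qed.

Lemma entry_upd w (i : 'I_N) x (s : nat) : s != i -> s != i.+1 ->
  entry (upd w i x) s = entry w s.
Proof.
move=> si si1; rewrite /entry; case: ifP => // _.
case: s si si1 => [|s] si si1; rewrite !item_upd (negPf si) ?eqSS// in si1 *.
by rewrite (negPf si1).
Qed.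

(** Within the signal [c], the only trace of an interior element of the opponent
is the value read by the next position. *)
Lemma view_upd par c w (i : 'I_N) x : odd i != par -> (i.+1 < N)%N ->
  view par w = c ->
  (view par (upd w i x) == c) = (B x (item e0 c i.+1).1 == (item e0 c i.+1).2).
Proof.
move=> ip iN <-.
have ip1 : odd i.+1 == par by move: ip; rewrite /=; case: odd; case: par.
have ci : item e0 (view par w) i.+1 = entry w i.+1 by rewrite item_view.
have ui : entry (upd w i x) i.+1 = (item x0 w i.+1, B x (item x0 w i.+1)).
  by rewrite /entry iN !item_upd eqxx gtn_eqF.
rewrite ci /entry iN /=; apply/eqP/eqP => [eqv|Bx].
  have := congr1 (fun c => item e0 c i.+1) eqv.
  by rewrite !item_view// ui /entry iN => -[].
apply/ffunP => s; rewrite !ffunE; case: ifP => // sp.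
have [si1|si1] := eqVneq (s : nat) i.+1.
  by rewrite si1 ui /entry iN Bx.
by rewrite entry_upd//; apply: contraTneq sp => ->.
Qed.

(** The last element of the chain is read by nobody. *)
Lemma view_upd_last par w (i : 'I_N) x : odd i != par -> i.+1 = N ->
  view par (upd w i x) = view par w.
Proof.
move=> ip iN; apply/ffunP => s; rewrite !ffunE; case: ifP => // sp.
rewrite entry_upd//; first by apply: contraTneq sp => ->.
by rewrite iN ltn_eqF.
Qed.

End Signals.

Definition passes (z : nat -> E) s := B (z s).1 (z s.+1).1 == (z s.+1).2.

Definition first_failure m z := find (fun s => ~~ passes z s) (iota 0 m).

(** The owner of position [s.+1] pays: player 2 for even [s], player 1 for odd
[s]. The last test is used with [m] even, hence concerns player 1; its price
5^-1 = 3/5 - 2/5 is the least expected loss of an earlier lie, so that player 1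
does not lie in order to escape it. The index [m] means that no test fails. *)
Definition blame m s : R :=
  if s == m then 0 else if s.+1 == m then - 5^-1 else (-1) ^+ s.

Definition verdict m z := blame m (first_failure m z).

Lemma first_failureE m z r :
  (r <= m)%N -> (forall s, (s < r)%N -> passes z s) ->
  (r < m)%N && passes z r = false -> first_failure m z = r.
Proof.
move=> rm ok nok; rewrite /first_failure -(subnKC rm) iotaD find_cat.
rewrite size_iota (_ : has _ _ = false); last first.
  by apply/hasPn => s; rewrite mem_iota negbK => /andP[_]; apply: ok.
move: nok rm; rewrite add0n -subn_gt0; case: (m - r)%N => [|d] //=.
  by rewrite addn0.
by move=> ->; rewrite addn0.
Qed.

Lemma verdict_fail m z r :
  (r.+1 < m)%N -> (forall s, (s < r)%N -> passes z s) ->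
  ~~ passes z r -> verdict m z = (-1) ^+ r.
Proof.
move=> rm ok nok; rewrite /verdict (@first_failureE _ _ r)//.
- by rewrite /blame !ltn_eqF// ltnW.
- by rewrite ltnW// ltnW.
- by rewrite (negPf nok) andbF.
Qed.

Lemma verdict_last n z : (forall s, (s < n)%N -> passes z s) ->
  verdict n.+1 z = if passes z n then 0 else - 5^-1.
Proof.
move=> ok; rewrite /verdict; case: ifP => pn.
  rewrite (@first_failureE _ _ n.+1) ?/blame ?eqxx// ?ltnn//.
  by move=> s; rewrite ltnS leq_eqVlt => /predU1P[->|/ok].
by rewrite (@first_failureE _ _ n) ?pn ?andbF// /blame ltn_eqF// eqxx.
Qed.

Lemma verdict_bound m z : -1 <= verdict m z <= 1.
Proof.
rewrite /verdict /blame; case: ifP => _; first lra.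
case: ifP => _; first lra.
by rewrite -signr_odd; case: odd; rewrite ?expr0 ?expr1; lra.
Qed.

Lemma eq_verdict m z z' : (forall s, (s <= m)%N -> z s = z' s) ->
  verdict m z = verdict m z'.
Proof.
move=> eqz; congr blame; apply: eq_in_find => s.
rewrite mem_iota /passes => /andP[_ sm].
by rewrite !eqz// ltnW.
Qed.

(** Against a uniform opponent's element every guess at the last test is as good
as any other. *)
Lemma sum_last_verdict b v :
  \sum_x (if B x b == v then 0 else - 5^-1 : R) = 1 - 5^-1 * #|X|%:R.
Proof.
rewrite (eq_bigr (fun x => (if B x b == v then 5^-1 else 0) - 5^-1));
  last first.
  by move=> x _; case: ifP; lra.
rewrite sumrB -big_mkcond.
rewrite (eq_bigl (fun x => x \in [set x | B x b == v])) => [|x]; last first.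
  by rewrite inE.
rewrite !sumr_const fiber -[_ *+ 5]mulr_natr -[_ *+ #|_|]mulr_natr.
by rewrite mulVf ?pnatr_eq0.
Qed.

Section Truth.
Variable N : nat.
Implicit Types (w : {ffun 'I_N -> X}) (y : nat -> E).

Lemma entry_passes w s : (s.+1 < N)%N -> passes (entry w) s.
Proof. by move=> sN; rewrite /passes /entry sN (ltnW sN). Qed.

Lemma verdict_truth n w : (n < N)%N ->
  verdict n.+1 (entry w) = if passes (entry w) n then 0 else - 5^-1.
Proof.
move=> nN; apply: verdict_last => s sn; apply: entry_passes.
exact: leq_ltn_trans nN.
Qed.

Lemma verdict_truth0 m w : (m < N)%N -> verdict m (entry w) = 0.
Proof.
case: m => [//|n] nN; rewrite verdict_truth 1?ltnW//.
by rewrite entry_passes.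
Qed.

(** Let [r.+1] be the position of the first lie of the player of parity [par];
(-1)^r is the verdict that blames this player. Given the own signal, the
opponent's element at [r] is uniform on a fiber of five elements, and at most
two of them let the lie pass test [r]. The remaining three give the full blame,
and the two others are counted as a full win of the liar, so that later reports
are irrelevant: 3/5 - 2/5 = 5^-1. *)
Lemma lie_blamed n par c y r :
  (r < n)%N -> (n < N)%N -> odd r.+1 == par ->
  (forall s, (s <= r)%N -> odd s == par -> y s = item e0 c s) ->
  y r.+1 != item e0 c r.+1 ->
  \sum_(w : {ffun 'I_N -> X} | view par w == c)
    (5^-1 - (-1) ^+ r * verdict n.+1 (interleave par y (entry w))) <= 0.
Proof.
move=> rn nN rp agree lie.
have rN : (r < N)%N by apply: ltn_trans nN.
have r1N : (r.+1 < N)%N by apply: leq_ltn_trans nN.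
have rp' : odd r != par by move: (par) rp => p; rewrite /=; case: odd; case: p.
(* After a passed test r the verdict is only bounded by 1. *)
pose ok w := B (item x0 w r) (y r.+1).1 == (y r.+1).2.
pose bnd w : R := if ok w then 6 / 5 else - (4 / 5).
apply: (@le_trans _ _ (\sum_(w | view par w == c) bnd w)).
  apply: ler_sum => w /eqP vw.
  have zE s : (s <= r)%N -> interleave par y (entry w) s = entry w s.
    rewrite /interleave => sr; case: ifP => // sp.
    by rewrite agree// -vw item_view.
  have pre s : (s < r)%N -> passes (interleave par y (entry w)) s.
    move=> sr; rewrite /passes !zE ?(ltnW sr)//; apply: entry_passes.
    by apply: leq_ltn_trans rN.
  have okE : passes (interleave par y (entry w)) r = ok w.
    by rewrite /passes zE// /interleave rp /entry rN.
  rewrite /bnd -okE; case: ifPn => [_|nok].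
    have := verdict_bound n.+1 (interleave par y (entry w)).
    by rewrite -signr_odd; case: odd; rewrite ?expr0 ?expr1; lra.
  by rewrite (verdict_fail _ pre nok)// -expr2 sqrr_sign; lra.
apply: (@resample _ _ _ (Ordinal rN)) => w /eqP vw.
set b := item e0 c r.+1 in lie.
under eq_bigl do rewrite (@view_upd _ _ c)//.
rewrite /bnd; under eq_bigr do rewrite /ok item_upd eqxx.
rewrite -/b.
have weigh (P Q : pred X) :
    \sum_(x | P x) (if Q x then 6 / 5 else - (4 / 5) : R) =
    2 * #|[set x | P x && Q x]|%:R - 4 / 5 * #|[set x | P x]|%:R.
  have cardE (S : pred X) : #|[set x | S x]|%:R = \sum_(x | S x) 1 :> R.
    by rewrite -sum1dep_card natr_sum.
  rewrite !cardE [\sum_(x | P x && Q x) _]big_mkcondr /= !mulr_sumr -sumrB.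
  by apply: eq_bigr => x _; case: (Q x); lra.
rewrite weigh fiber.
have := @collide b.1 b.2 (y r.+1).1 (y r.+1).2.
rewrite -!surjective_pairing eq_sym lie => /(_ isT).
rewrite -(ler_nat R); lra.
Qed.

(** Position 0 is tested by the score of the forecast only, so agreement there
is an assumption for player 1; every later lie is at the head of a test. *)
Lemma first_lie n par c y :
  (par = false -> y 0 = item e0 c 0) ->
  (exists r, [/\ (r < n)%N, odd r.+1 == par,
     forall s, (s <= r)%N -> odd s == par -> y s = item e0 c s &
     y r.+1 != item (n := N) e0 c r.+1]) \/
  (forall s, (s <= n)%N -> odd s == par -> y s = item e0 c s).
Proof.
move=> y0.
pose bad r := [&& (r < n)%N, odd r.+1 == par & y r.+1 != item e0 c r.+1].
have [/existsP[q badq]|nobad] := boolP [exists r : 'I_n, bad r]; last first.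
  right=> -[_ /eqP /esym /y0//|s] sn sp; apply/eqP; apply: contraNT nobad => ne.
  by apply/existsP; exists (Ordinal sn); rewrite /bad sn sp.
have some_bad : exists r, bad r by exists q.
left; case: (ex_minnP some_bad) => r /and3P[rn rp ne] minr.
exists r; split=> // -[_ /eqP /esym /y0//|s] sr sp.
apply/eqP/negPn/negP => nes; have : (r <= s)%N.
  by apply: minr; rewrite /bad sp nes (ltn_trans sr rn).
by rewrite leqNgt sr.
Qed.

(** With [n] odd the last test concerns player 1, so all the lies of player 2
are covered by [lie_blamed]. *)
Lemma honesty_optimal2 n c y : (n < N)%N -> odd n ->
  \sum_(w : {ffun 'I_N -> X} | view true w == c)
    (verdict n.+1 (entry w) - verdict n.+1 (interleave true y (entry w))) <= 0.
Proof.
move=> nN n_odd; have [//|[r [rn rp agree lie]]|agree] := @first_lie n true c y.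
  apply: le_trans (lie_blamed rn nN rp agree lie); apply: ler_sum => w _.
  rewrite -signr_odd; move: rp; rewrite /= => /eqP/negbTE->.
  rewrite expr0 mul1r.
  by rewrite verdict_truth//; case: ifP; lra.
apply: sumr_le0 => w /eqP vw.
rewrite subr_le0 le_eqVlt; apply/orP; left; apply/eqP.
apply: eq_verdict => s; rewrite leq_eqVlt ltnS /interleave => /predU1P[->|sn].
  by rewrite /= n_odd.
by case: ifP => // sp; rewrite agree// -vw item_view.
Qed.

(** Player 1 may also deviate at the last position only. If the chain contains
it, the truth passes and cannot be improved upon. If the chain stops just
before it, the opponent's last element is uniform given the signal of player 1,
and all guesses are equivalent. *)
Lemma honesty_optimal1 n c y : (n < N)%N -> odd n -> y 0 = item e0 c 0 ->
  \sum_(w : {ffun 'I_N -> X} | view false w == c)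
    (verdict n.+1 (interleave false y (entry w)) - verdict n.+1 (entry w)) <= 0.
Proof.
move=> nN n_odd y0.
have [//|[r [rn rp agree lie]]|agree] := @first_lie n false c y.
  apply: le_trans (lie_blamed rn nN rp agree lie); apply: ler_sum => w _.
  rewrite -signr_odd; move: rp; rewrite /= => /eqP/negbFE->; rewrite expr1.
  by rewrite verdict_truth//; case: ifP; lra.
have agreew w s : view false w = c -> (s <= n)%N ->
    interleave false y (entry w) s = entry w s.
  move=> vw sn; rewrite /interleave; case: ifP => // sp.
  by rewrite agree// -vw item_view.
have vE w : view false w = c -> verdict n.+1 (interleave false y (entry w)) =
    if passes (interleave false y (entry w)) n then 0 else - 5^-1.
  move=> vw; apply: verdict_last => s sn.
  rewrite /passes !agreew// 1?ltnW//; apply: entry_passes.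
  exact: leq_ltn_trans nN.
have pE w : view false w = c -> passes (interleave false y (entry w)) n =
    (B (item x0 w n) (y n.+1).1 == (y n.+1).2).
  by move=> vw; rewrite /passes agreew// /interleave /= n_odd /entry nN.
have [n1N|Nn1] := ltnP n.+1 N.
  apply: sumr_le0 => w /eqP vw; rewrite verdict_truth0// vE//.
  by case: ifP => _; lra.
have {Nn1}n1N : n.+1 = N by apply/eqP; rewrite eqn_leq nN.
have lastE w : passes (entry w) n = (B (item x0 w n) x0 == v0).
  by rewrite /passes /entry nN n1N ltnn.
apply: (@resample _ _ _ (Ordinal nN)) => w /eqP vw.
have vwx x : view false (upd w (Ordinal nN) x) = c.
  by rewrite view_upd_last //= n_odd.
under eq_bigl do rewrite vwx eqxx.
under eq_bigr do rewrite vE// pE// verdict_truth// lastE !item_upd !eqxx.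
by rewrite sumrB !sum_last_verdict subrr.
Qed.

(** The final guess passes for 5 of the 25 values of the last element, and costs
5^-1 otherwise: 4/25 = 5^-1 * (1 - 5/25). *)
Lemma mean_verdict_last n : n.+1 = N -> #|X| = 25%N ->
  \sum_(w : {ffun 'I_N -> X}) (verdict n.+1 (entry w) + 4 / 25) <= 0.
Proof.
move=> n1N cX; have nN : (n < N)%N by rewrite -n1N.
apply: (@resample _ _ _ (Ordinal nN) xpredT) => w _.
under eq_bigr do
  rewrite verdict_truth// /passes /entry nN n1N ltnn /= item_upd eqxx.
rewrite big_split /= sum_last_verdict sumr_const cX; lra.
Qed.

End Truth.
End Chain.

(** * Parabolas over a finite field *)

Section ParabolaCode.
Variable F : finFieldType.

(** The element (t, y) is read through the slopes [b] at abscissa t, masked by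
the additive noise y. *)
Definition parabola (f b : F * F) : F := f.2 + b.1 * f.1 + b.2 * f.1 ^+ 2.

(** The noise makes the value independent of the abscissa. *)
Lemma card_parabola b v : #|[set f | parabola f b == v]| = #|F|.
Proof.
rewrite -(@card_imset _ _ (fun t => (t, v - b.1 * t - b.2 * t ^+ 2)));
  last first.
  by move=> t t' [].
apply: eq_card => -[t y]; rewrite inE; apply/eqP/imsetP => [<-|[t' _ [-> ->]]].
  by exists t => //; congr pair; rewrite /parabola /=; ring.
by rewrite /parabola /=; ring.
Qed.

(** Once y is eliminated, the abscissa is a root of the difference of the two
readings, a polynomial of degree at most 2. It does not vanish identically:
there is no free constant term in [parabola], so its three coefficients control
v - v' and b - b'. *)
Lemma card_two_parabolas b v b' v' : (b, v) != (b', v') ->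
  (#|[set f | (parabola f b == v) && (parabola f b' == v')]| <= 2)%N.
Proof.
move=> ne; set S := finset _.
pose p := Poly [:: v - v'; b'.1 - b.1; b'.2 - b.2].
have inS t y : (t, y) \in S -> y = v - b.1 * t - b.2 * t ^+ 2 /\ root p t.
  rewrite inE /root horner_Poly /= /parabola /= => /andP[/eqP<- /eqP<-].
  by split; [ring|apply/eqP; ring].
have p0 : p != 0.
  apply: contraNneq ne => p0.
  have co i : [:: v - v'; b'.1 - b.1; b'.2 - b.2]`_i = 0.
    by rewrite -coef_Poly -/p p0 coef0.
  move: (co 0) (co 1%N) (co 2%N) => /= /subr0_eq-> /subr0_eq e1 /subr0_eq e2.
  by rewrite (surjective_pairing b) (surjective_pairing b') e1 e2.
rewrite -(@card_in_imset _ _ fst S); last first.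
  by move=> [t y] [t' y'] /inS[-> _] /inS[-> _] /= ->.
rewrite cardE -ltnS.
apply: leq_trans (max_poly_roots p0 _ (enum_uniq _)) (size_Poly _).
apply/allP => t; rewrite mem_enum => /imsetP[[t' y] /inS[_ rt] ->].
exact: rt.
Qed.

End ParabolaCode.

(** * The information structures and the quiz *)

Section Structures.
Variables (R : realType) (K : finType) (k0 k1 : K).
Hypothesis k01 : k0 != k1.
Variables (X V : finType) (x0 : X) (v0 : V) (B : X -> X -> V).
Hypothesis fiber : forall b v, #|[set x | B x b == v]| = 5%N.
Hypothesis collide : forall b v b' v', (b, v) != (b', v') ->
  (#|[set x | (B x b == v) && (B x b' == v')]| <= 2)%N.
Hypothesis cardX : #|X| = 25%N.

Local Notation E := (X * V)%type.
Local Notation e0 := (x0, v0).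
Local Notation entry := (entry x0 v0 B).
Local Notation view := (view x0 v0 B).
Local Notation verdict := (@verdict R X V B).

(** Conditional probability of the state [k1]. It is injective, so that the
forecast reveals the whole first entry. *)
Definition belief (e : E) : R := (enum_rank e)%:R / #|{: E}|%:R.

(** Small enough for the score of [quiz] to outweigh all the tests: beliefs are
at least 1 / #|E| apart, a wrong forecast loses half the square of the gap, and
the verdicts differ by at most 2. *)
Definition stake : R := (4 * #|{: E}|%:R ^+ 2)^-1.

Let cardE0 : 0 < #|{: E}|%:R :> R.
Proof. by rewrite ltr0n; apply/card_gt0P; exists e0. Qed.

Lemma stake_gt0 : 0 < stake.
Proof. by rewrite invr_gt0 mulr_gt0 ?exprn_gt0. Qed.

Lemma stake_le : stake <= 4^-1.
Proof.
rewrite /stake lef_pV2 ?posrE ?mulr_gt0 ?exprn_gt0// ler_peMr//.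
by rewrite -natrX ler1n expn_gt0 -(ltr0n R) cardE0.
Qed.

Lemma belief_bound e : 0 <= belief e <= 1.
Proof.
rewrite divr_ge0 ?ler0n//= ler_pdivrMr// mul1r ler_nat.
exact: ltnW (ltn_ord _).
Qed.

Lemma belief_gap e e' : e != e' -> 4 * stake <= (belief e - belief e') ^+ 2.
Proof.
move=> ne; have -> : 4 * stake = #|{: E}|%:R ^- 2.
  by rewrite /stake invfM mulrA divff ?mul1r// pnatr_eq0.
rewrite /belief -mulrBl exprMn -[leLHS]mul1r exprVn.
rewrite ler_wpM2r ?invr_ge0 ?exprn_ge0 ?ler0n//.
have : enum_rank e != enum_rank e' :> nat.
  by rewrite (inj_eq val_inj) (inj_eq enum_rank_inj).
by rewrite neq_ltn => /orP[]; rewrite -(ler_nat R) -natr1; nra.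
Qed.

Section Structure.
Variable N : nat.

Definition scenario : finType := ({ffun 'I_N -> X} * bool)%type.

Definition prior (w : scenario) : R :=
  #|{ffun 'I_N -> X}|%:R^-1 *
  (if w.2 then belief (entry w.1 0) else 1 - belief (entry w.1 0)).

Let cardO : 0 < #|{ffun 'I_N -> X}|%:R :> R.
Proof. by rewrite ltr0n; apply/card_gt0P; exists [ffun=> x0]. Qed.

Lemma prior_ge0 w : 0 <= prior w.
Proof.
rewrite mulr_ge0 ?invr_ge0 ?ler0n//.
by have := belief_bound (entry w.1 0); case: w.2; lra.
Qed.

Lemma sum_prior (P : pred {ffun 'I_N -> X}) G :
  \sum_(w : scenario | P w.1) prior w * G w =
  #|{ffun 'I_N -> X}|%:R^-1 * \sum_(f | P f)
    (belief (entry f 0) * G (f, true) +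
     (1 - belief (entry f 0)) * G (f, false)).
Proof.
transitivity (\sum_(f | P f) \sum_b prior (f, b) * G (f, b)).
  by rewrite pair_big_dep; apply: eq_big => [w|[]]; rewrite ?andbT.
rewrite big_distrr /=; apply: eq_bigr => f _.
by rewrite big_bool /prior /=; ring.
Qed.

Lemma prior_sum1 : \sum_w prior w = 1.
Proof.
rewrite (eq_bigr (fun w => prior w * 1)) => [|w _]; last by rewrite mulr1.
rewrite (sum_prior xpredT) (eq_bigr (fun=> 1)) => [|f _]; last by ring.
by rewrite sumr_const mulVf// gt_eqF.
Qed.

Definition state_of (w : scenario) : K := if w.2 then k1 else k0.
Definition signal par (w : scenario) := view par w.1.

Definition structure : info_structure R K :=
  from_prior state_of (signal false) (signal true) prior_ge0 prior_sum1.

End Structure.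

Definition report m N (c : {ffun 'I_N -> E}) : {ffun 'I_m.+1 -> E} :=
  [ffun s : 'I_m.+1 => item e0 c s].

(** [i] is the report of player 1 and [j] that of player 2. *)
Definition quiz m (k : K) (i j : {ffun 'I_m.+1 -> E}) : R :=
  - (((k == k1)%:R - belief (item e0 i 0)) ^+ 2 / 2) +
  stake * verdict m (interleave false (item e0 i) (item e0 j)).

Lemma quiz_payoff m : payoff_function (@quiz m).
Proof.
split; try by apply/card_gt0P; exists [ffun=> e0].
move=> k i j; rewrite /quiz.
have := verdict_bound R B m (interleave false (item e0 i) (item e0 j)).
set v := verdict _ _; have := belief_bound (item e0 i 0); set p := belief _.
have := stake_gt0; have := stake_le.
case: eqP => _ /=; nra.
Qed.

Lemma item_report m N (c : {ffun 'I_N -> E}) s : (s <= m)%N ->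
  item e0 (report m c) s = item e0 c s.
Proof. by move=> sm; rewrite /report (item_finfun _ _ (item e0 c)) ltnS sm. Qed.

Lemma verdict_report2 m N (f : {ffun 'I_N -> X}) z :
  verdict m (interleave false z (item e0 (report m (view true f)))) =
  verdict m (interleave false z (entry f)).
Proof.
apply: eq_verdict => s sm; rewrite /interleave item_report//.
by case: ifP => // sp; rewrite item_view//; case: odd sp.
Qed.

Lemma verdict_report1 m N (f : {ffun 'I_N -> X}) z :
  verdict m (interleave false (item e0 (report m (view false f))) z) =
  verdict m (interleave true z (entry f)).
Proof.
apply: eq_verdict => s sm; rewrite /interleave item_report//.
by case: ifP => sp; [rewrite item_view// (eqP sp)|case: odd sp].
Qed.

Lemma verdict_report m N (f : {ffun 'I_N -> X}) :
  verdict m (interleave false (item e0 (report m (view false f)))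
                        (item e0 (report m (view true f)))) =
  verdict m (entry f).
Proof.
rewrite verdict_report2; apply: eq_verdict => s sm.
rewrite /interleave item_report//.
by case: ifP => // sp; rewrite item_view.
Qed.

(** Truthful reports form a saddle point for every chain that reaches the last
test, whether or not it contains the position that this test concerns. The
second term is the expected quadratic score of a correct forecast. *)
Lemma quiz_val n N : (n < N)%N -> odd n ->
  game_val (structure N) (@quiz n.+1) =
  #|{ffun 'I_N -> X}|%:R^-1 * \sum_(f : {ffun 'I_N -> X})
     (stake * verdict n.+1 (entry f) -
      belief (entry f 0) * (1 - belief (entry f 0)) / 2).
Proof.
move=> nN n_odd.
have cardO : 0 <= #|{ffun 'I_N -> X}|%:R^-1 :> R by rewrite invr_ge0 ler0n.
have st := stake_gt0.
rewrite (@game_val_interim_saddle _ _ _ _ _ _ _ _ _ _ _ _ _ _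
  (@report n.+1 N) (@report n.+1 N)).
- rewrite (sum_prior xpredT); congr (_ * _); apply: eq_bigr => f _.
  rewrite /quiz /signal /state_of !verdict_report /= !item_report// item_view//.
  by rewrite eqxx (negPf k01) mulr1n mulr0n; field.
- exact: quiz_payoff.
- move=> q j; rewrite (sum_prior (fun f => view true f == q)) mulr_ge0//.
  rewrite -oppr_le0 -sumrN.
  apply: (@le_trans _ _ (\sum_(f | view true f == q) stake *
     (verdict n.+1 (entry f) -
      verdict n.+1 (interleave true (item e0 j) (entry f))))).
    apply: ler_sum => f /eqP <-; rewrite /quiz /signal /state_of /=.
    by rewrite !verdict_report verdict_report1; lra.
  rewrite -mulr_sumr pmulr_rle0//; exact: honesty_optimal2.
- move=> q i; rewrite (sum_prior (fun f => view false f == q)) mulr_ge0_le0//.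
  (* Averaging over the state turns the loss of score into the squared error of
     the forecast. *)
  have termE f : view false f = q ->
      belief (entry f 0) *
        (quiz k1 i (report n.+1 (view true f)) -
         quiz k1 (report n.+1 q) (report n.+1 (view true f))) +
      (1 - belief (entry f 0)) *
        (quiz k0 i (report n.+1 (view true f)) -
         quiz k0 (report n.+1 q) (report n.+1 (view true f))) =
      stake * (verdict n.+1 (interleave false (item e0 i) (entry f)) -
               verdict n.+1 (entry f))
      - (belief (item e0 q 0) - belief (item e0 i 0)) ^+ 2 / 2.
    move=> <-; rewrite /quiz !verdict_report verdict_report2.
    rewrite !item_report// !item_view// eqxx (negPf k01) mulr1n mulr0n.
    by field.
  have [i0|i0] := eqVneq (item e0 i 0) (item e0 q 0); last first.
    apply: sumr_le0 => f /eqP vf; rewrite termE//.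
    have := belief_gap i0.
    have := verdict_bound R B n.+1 (interleave false (item e0 i) (entry f)).
    rewrite verdict_truth//.
    rewrite -[X in X / 2]sqrrN opprB.
    by case: ifP => _; nra.
  apply: (@le_trans _ _ (\sum_(f | view false f == q) stake *
     (verdict n.+1 (interleave false (item e0 i) (entry f)) -
      verdict n.+1 (entry f)))).
    by apply: ler_sum => f /eqP vf; rewrite termE// i0 subrr; lra.
  rewrite -mulr_sumr pmulr_rle0//; exact: honesty_optimal1.
Qed.

(** The expected score must not depend on the length of the chain: only the
verdicts may separate two structures. *)
Lemma mean_first_entry N (phi : E -> R) : (0 < N)%N ->
  #|{ffun 'I_N -> X}|%:R^-1 * \sum_(f : {ffun 'I_N -> X}) phi (entry f 0) =
  25^-1 * \sum_x phi (x, v0).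
Proof.
move=> N0; set M := 25^-1 * _.
have cardO : 0 < #|{ffun 'I_N -> X}|%:R :> R.
  by rewrite ltr0n; apply/card_gt0P; exists [ffun=> x0].
have avg (psi : E -> R) : \sum_x psi (x, v0) = 0 ->
    \sum_(f : {ffun 'I_N -> X}) psi (entry f 0) <= 0.
  move=> psi0; apply: (@resample _ _ _ (Ordinal N0) xpredT) => f _.
  under eq_bigr do rewrite /entry N0 item_upd eqxx.
  by rewrite psi0.
have cM : \sum_x (phi (x, v0) - M) = 0.
  rewrite sumrB sumr_const cardX -[M *+ _]mulr_natl mulrA mulfV ?pnatr_eq0//.
  by rewrite mul1r subrr.
have hi := avg (fun e => phi e - M) cM.
have lo : \sum_(f : {ffun 'I_N -> X}) - (phi (entry f 0) - M) <= 0.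
  by apply: (avg (fun e => - (phi e - M))); rewrite sumrN cM oppr0.
have /eqP : \sum_(f : {ffun 'I_N -> X}) (phi (entry f 0) - M) = 0.
  by apply/eqP; rewrite eq_le hi /= -oppr_le0 -sumrN.
rewrite sumrB sumr_const subr_eq0 => /eqP->.
by rewrite -[M *+ _]mulr_natl mulrA mulVf ?mul1r// gt_eqF.
Qed.

(** Lacking the last position costs player 1 the price of failing the final
guess; the scores cancel. *)
Lemma quiz_val_gap n N : odd n -> (n.+1 < N)%N ->
  game_val (structure n.+1) (@quiz n.+1) + stake * (4 / 25) <=
  game_val (structure N) (@quiz n.+1).
Proof.
move=> n_odd nN; rewrite !quiz_val// 1?ltnW// !sumrB !mulrBr.
pose phi e := belief e * (1 - belief e) / 2.
rewrite (@mean_first_entry _ phi)// (@mean_first_entry N phi)//; last first.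
  exact: leq_ltn_trans nN.
rewrite [X in _ <= X - _](_ : _ = 0); last first.
  by rewrite big1 ?mulr0// => f _; rewrite verdict_truth0// mulr0.
have := @mean_verdict_last R _ _ x0 v0 _ fiber _ _ (erefl n.+1) cardX.
rewrite big_split /= sumr_const -mulr_sumr.
set cO := #|_|; have cO0 : 0 < cO%:R :> R.
  by rewrite ltr0n; apply/card_gt0P; exists [ffun=> x0].
rewrite -[_ *+ cO]mulr_natr; set S := bigop.body _ _ _.
move: stake stake_gt0 => st st0 le0.
have : st * (cO%:R^-1 * (S + 4 / 25 * cO%:R)) <= 0.
  by rewrite pmulr_rle0// pmulr_rle0 ?invr_gt0.
have -> : st * (cO%:R^-1 * (S + 4 / 25 * cO%:R)) =
    cO%:R^-1 * (st * S) + st * (4 / 25).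
  by move: cO0; move: cO%:R => c c0; field; rewrite gt_eqF.
lra.
Qed.
End Structures.

(** * Lower bounds on the distance *)

Lemma value_dist_ge (R : realType) (K : finType) (u v : info_structure R K)
    (I J : finType) (g : K -> I -> J -> R) :
  (forall (I J : finType) (g : K -> I -> J -> R), payoff_function g ->
     -1 <= game_val u g <= 1 /\ -1 <= game_val v g <= 1) ->
  payoff_function g -> `|game_val u g - game_val v g| <= value_dist u v.
Proof.
move=> bnd pg; apply: ub_le_sup; last by exists I, J, g.
exists 2 => _ [I' [J' [g' [/bnd[bu bv] ->]]]].
case/andP: bu; case/andP: bv.
move: (game_val u g') (game_val v g') => a b ????.
by rewrite ler_norml; lra.
Qed.

Theorem theorem2 (R : realType) (K : finType) (hK : (2 <= #|K|)%N) :
  exists (eps : R) (u : nat -> info_structure R K),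
    0 < eps /\
    forall l p : nat, (1 <= l)%N -> (1 <= p)%N -> l <> p ->
      eps < value_dist (u l) (u p).
Proof.
have /card_gt1P[k0 [k1 [_ _ k01]]] := hK.
pose F := 'F_5; have cF : #|F| = 5%N by rewrite card_Fp.
pose B := @parabola F.
have fiber b v : #|[set x | B x b == v]| = 5%N by rewrite card_parabola.
have collide := @card_two_parabolas F.
have cX : #|{: F * F}| = 25%N by rewrite card_prod cF.
pose u l := structure R k0 k1 (0 : F * F) (0 : F) B l.*2.
pose st := stake R (F * F)%type F.
have st0 : 0 < st := stake_gt0 R (0 : F * F) (0 : F).
exists (st * (2 / 25)), u; split; first by rewrite mulr_gt0//; lra.
have bnd l (I J : finType) (g : K -> I -> J -> R) : payoff_function g ->
    -1 <= game_val (u l) g <= 1 by exact: game_val_bound.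
have main l p : (1 <= l)%N -> (l < p)%N ->
    exists (I J : finType) (g : K -> I -> J -> R), payoff_function g /\
      game_val (u l) g + st * (4 / 25) <= game_val (u p) g.
  case: l => // l _ lp; exists _, _, (quiz R k1 (0 : F * F) (0 : F) B
    (m := l.+1.*2)).
  split; first exact: quiz_payoff.
  apply: quiz_val_gap => //=; first by rewrite odd_double.
  by rewrite -doubleS ltn_double.
have dist l p (I J : finType) (g : K -> I -> J -> R) : payoff_function g ->
    `|game_val (u l) g - game_val (u p) g| <= value_dist (u l) (u p).
  by apply: value_dist_ge => I' J' g' pg'; split; apply: bnd.
clearbody st.
move=> l p l1 p1 /eqP; rewrite neq_ltn => /orP[lp|pl].
  have [I [J [g [pg gap]]]] := main l p l1 lp.
  apply: lt_le_trans (dist l p _ _ _ pg).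
  move: (game_val (u l) g) (game_val (u p) g) gap => vl vp gap.
  by rewrite lter_normr; apply/orP; right; lra.
have [I [J [g [pg gap]]]] := main p l p1 pl.
apply: lt_le_trans (dist l p _ _ _ pg).
move: (game_val (u l) g) (game_val (u p) g) gap => vl vp gap.
by rewrite lter_normr; apply/orP; left; lra.
Qed.
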